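(* Let $\lambda,\mu,\theta,\Delta>0$ and $\rho:=\lambda/\mu$. The first-order Taylor approximation of the amplitude (defined in the context) is $$\frac{\rho}{2}-\frac{\rho-\rho\left(\dfrac{1-e^{-\mu\Delta}}{1+e^{-\rho\theta}}\right)}{1+e^{-\mu\Delta}-\dfrac{\rho\theta}{2}\,\mathrm{sech}^2\left(-\dfrac{\rho\theta}{2}\right)\left(1-e^{-\mu\Delta}\right)} .$$
   Context: Consider the two-queue updating system $\dot q_i(t)=\lambda\,\frac{\exp(-\theta q_i(\Phi(t,\Delta)))}{\sum_{j=1}^2\exp(-\theta q_j(\Phi(t,\Delta)))}-\mu q_i(t)$, $i=1,2$, with $\Phi(t,\Delta)=\lfloor t/\Delta\rfloor\Delta$. The amplitude of its steady-state oscillations is $\frac{\rho}{2}-L$, where $L$ solves the fixed-point equation $\rho-L=Le^{-\mu\Delta}+\rho f(L)(1-e^{-\mu\Delta})$ with the multinomial logit function $f(x)=\frac{e^{-\theta x}}{e^{-\theta x}+e^{-\theta(\rho-x)}}=\frac{1}{1+e^{-\theta(\rho-2x)}}$. The first-order Taylor approximation of the amplitude is the number $\frac{\rho}{2}-L_1$, where $L_1$ is the solution of the linear equation obtained by replacing $f(L)$ in the fixed-point equation by its first-order Taylor polynomial at $0$: $\rho-L_1=L_1e^{-\mu\Delta}+\rho\left(f(0)+f'(0)L_1\right)(1-e^{-\mu\Delta})$. *)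

(* Defs.v *)
From Stdlib Require Import Reals.
From Coquelicot Require Import Coquelicot.

Open Scope R_scope.

Definition mnl (rho theta x : R) : R :=
  exp (- theta * x) / (exp (- theta * x) + exp (- theta * (rho - x))).

(* For [f := mnl rho theta], a solution [L] gives the amplitude [rho / 2 - L]
   of the steady-state oscillations. *)
Definition fixed_point_eq (rho mu Delta : R) (f : R -> R) (L : R) : Prop :=
  rho - L = L * exp (- mu * Delta) + rho * f L * (1 - exp (- mu * Delta)).

Definition taylor1 (f : R -> R) (a x : R) : R := f a + Derive f a * (x - a).

(* Uniqueness is required because the approximation is built from *the*
   solution of the linearised equation. *)
Definition is_taylor1_amplitude (rho mu theta Delta a : R) : Prop :=
  exists L1 : R,
    unique (fixed_point_eq rho mu Delta (taylor1 (mnl rho theta) 0)) L1 /\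
    a = rho / 2 - L1.

Definition sech (x : R) : R := / cosh x.

(* Main.v *)
Require Import Defs.
From Stdlib Require Import Reals Lra.
From Coquelicot Require Import Coquelicot.

Open Scope R_scope.

(** Write [E = exp (- mu * Delta)], so [0 < E < 1].  Replacing [f] by its Taylor
    polynomial at [0] turns the fixed-point equation into the linear equation
    [L * (1 + E + rho * f'(0) * (1 - E)) = rho - rho * f(0) * (1 - E)],
    so everything reduces to computing [f(0)] and [f'(0)], and to showing that
    the coefficient of [L] does not vanish.

    The derivative comes from centring the logit function at its inflection
    point [rho / 2]: in the variable [u = theta * (x - rho / 2)] it is
    [exp (- u) / (exp (- u) + exp u)], whose derivative in [u] is
    [- sech u ^ 2 / 2] ([is_derive_mnl]).

    With [y = rho * theta / 2] the coefficient of [L] is then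
    [1 + E - y * sech y ^ 2 * (1 - E)].  Since [y < cosh y ^ 2] for every real
    [y] ([lt_cosh_sqr]), it exceeds [1 + E - (1 - E) = 2 * E > 0], so the linear
    equation has exactly one solution. *)

(** Centring at [rho / 2] pulls the common factor [exp (- theta * rho / 2)] out
    of both exponentials. *)
Lemma mnl_centred (rho theta x : R) :
  let u := theta * (x - rho / 2) in
  mnl rho theta x = exp (- u) / (exp (- u) + exp u).
Proof.
  intros u; unfold mnl.
  replace (- theta * x) with (- theta * rho / 2 + - u) by (unfold u; field).
  replace (- theta * (rho - x)) with (- theta * rho / 2 + u)
    by (unfold u; field).
  rewrite !exp_plus.
  pose proof (exp_pos (- theta * rho / 2)).
  pose proof (exp_pos u). pose proof (exp_pos (- u)).
  field; split; nra.
Qed.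

Lemma mnl_0 (rho theta : R) : mnl rho theta 0 = / (1 + exp (- rho * theta)).
Proof.
  unfold mnl.
  replace (- theta * 0) with 0 by ring.
  replace (- theta * (rho - 0)) with (- rho * theta) by ring.
  rewrite exp_0. pose proof (exp_pos (- rho * theta)).
  field; lra.
Qed.

Lemma is_derive_mnl (rho theta x : R) :
  is_derive (mnl rho theta) x
    (- (theta / 2) * sech (theta * (x - rho / 2)) ^ 2).
Proof.
  apply (is_derive_ext (fun t => exp (- (theta * (t - rho / 2))) /
    (exp (- (theta * (t - rho / 2))) + exp (theta * (t - rho / 2))))).
  { intros t; symmetry; apply mnl_centred. }
  unfold sech, cosh.
  auto_derive; change (x + - (rho / 2)) with (x - rho / 2);
    set (u := theta * (x - rho / 2));
    pose proof (exp_pos u); pose proof (exp_pos (- u)).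
  - lra.
  - assert (Hinv : exp (- u) = / exp u) by apply exp_Ropp.
    rewrite Hinv. field. split; nra.
Qed.

(** [cosh y ^ 2 >= 2 * cosh y - 1 > exp y - 1 >= y]. *)
Lemma lt_cosh_sqr (y : R) : y < cosh y ^ 2.
Proof.
  pose proof (exp_ineq1_le y). pose proof (exp_pos (- y)).
  assert (Hc : exp y < 2 * cosh y) by (unfold cosh; lra).
  pose proof (pow2_ge_0 (cosh y - 1)).
  lra.
Qed.

(** This keeps the coefficient of the linearised equation away from [0]; [sech]
    is taken at [- y] because the inflection point [rho / 2] lies to the right
    of the expansion point [0]. *)
Lemma mul_sech_sqr_lt_1 (y : R) : y * sech (- y) ^ 2 < 1.
Proof.
  assert (Hc : cosh (- y) = cosh y)
    by (unfold cosh; rewrite Ropp_involutive; field).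
  pose proof (lt_cosh_sqr y).
  assert (Hpos : 0 < cosh y)
    by (unfold cosh; pose proof (exp_pos y); pose proof (exp_pos (- y)); lra).
  unfold sech; rewrite Hc, pow_inv.
  apply (Rdiv_lt_1 y (cosh y ^ 2)); [apply pow_lt |]; assumption.
Qed.

Theorem theorem2p3 (lambda mu theta Delta : R)
  (hlambda : 0 < lambda) (hmu : 0 < mu) (htheta : 0 < theta)
  (hDelta : 0 < Delta) :
  let rho := lambda / mu in
  is_taylor1_amplitude rho mu theta Delta
    (rho / 2 -
     (rho - rho * ((1 - exp (- mu * Delta)) / (1 + exp (- rho * theta)))) /
     (1 + exp (- mu * Delta)
      - rho * theta / 2 * (sech (- (rho * theta / 2))) ^ 2
        * (1 - exp (- mu * Delta)))).
Proof.
  intros rho.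
  assert (HD : Derive (mnl rho theta) 0 =
               - (theta / 2) * sech (- (rho * theta / 2)) ^ 2).
  { apply is_derive_unique.
    replace (- (rho * theta / 2)) with (theta * (0 - rho / 2)) by field.
    apply is_derive_mnl. }
  assert (HE : exp (- mu * Delta) < 1).
  { rewrite <- exp_0; apply exp_increasing; nra. }
  pose proof (exp_pos (- mu * Delta)) as HE0.
  pose proof (exp_pos (- rho * theta)) as HG.
  pose proof (mul_sech_sqr_lt_1 (rho * theta / 2)) as HS.
  unfold is_taylor1_amplitude, unique, fixed_point_eq, taylor1.
  rewrite HD, mnl_0.
  set (E := exp (- mu * Delta)) in *.
  set (G := exp (- rho * theta)) in *.
  set (s := sech (- (rho * theta / 2)) ^ 2) in *.
  set (D := 1 + E - rho * theta / 2 * s * (1 - E)).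
  set (N := rho - rho * ((1 - E) / (1 + G))).
  assert (HDpos : 0 < D) by (unfold D; nra).
  assert (Hlin : forall L : R,
    rho - L = L * E + rho * (/ (1 + G) + - (theta / 2) * s * (L - 0)) * (1 - E)
    <-> L * D = N).
  { intros L; unfold D, N, Rdiv; split; intros HL; lra. }
  exists (N / D); split; [split |].
  - apply Hlin. field. lra.
  - intros L HL. apply Hlin in HL. rewrite <- HL. field. lra.
  - reflexivity.
Qed.
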